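(* Let $(T_n)_{n\ge 1}$ be a uniform random recursive tree and let $R_n$ be the closeness rank of the root (vertex $1$) in $T_n$. Closeness centrality is not good for root estimation; that is, the sequence of random variables $\{R_n\}_{n\ge1}$ is not tight: it is not the case that for every $\epsilon>0$ there exists a positive integer $K$ such that $\mathbb{P}(R_n\le K)\ge 1-\epsilon$ for all $n$.
   Context: A uniform random recursive tree (URRT) is a random sequence of trees $(T_n)_{n\ge 1}$ with $V(T_n)=[n]=\{1,\ldots,n\}$: $T_1$ is the single vertex $1$ (the root), and $T_{n+1}$ is obtained from $T_n$ by adding vertex $n+1$ and an edge $\{i,n+1\}$, where $i$ is chosen uniformly at random from $[n]$, independently of the past. The closeness centrality of $v\in V(T_n)$ is $\mathcal{C}_{T_n}(v)=\sum_{u\in V(T_n)\setminus\{v\}}\mathrm{dist}(v,u)$, where $\mathrm{dist}(v,u)$ is the length of the path between $v$ and $u$ in $T_n$; smaller values correspond to more central vertices. Ranking: vertices are ordered from most to least central; vertices with equal centrality value are ordered in reverse order of insertion time (if $u,v$ have equal centrality, $u$ is ranked before $v$ iff $u>v$). This gives a permutation $\gamma_n$ of $[n]$, where $\gamma_n(v)\in\{1,\ldots,n\}$ is the position of $v$ in this order (position $1$ being most central). The rank of the root is $R_n=\gamma_n(1)$. A centrality measure is good for root estimation if the corresponding sequence $\{R_n\}$ is tight, i.e. for every $\epsilon>0$ there exists a positive integer $K$ such that for all $n$, $\mathbb{P}(R_n\le K)\ge 1-\epsilon$. *)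

(* Defs.v *)
(* MathComp / MathComp-Analysis. *)
From mathcomp Require Import all_boot all_order all_algebra.
From mathcomp Require Import all_classical all_reals all_analysis.

Set Implicit Arguments.
Unset Strict Implicit.
Unset Printing Implicit Defensive.

Import Order.TTheory GRing.Theory Num.Theory.

(* A graph on the vertex set [n] = {1, ..., n} is given by its set of edges,
   an edge being an unordered pair of vertices.  The ordinal i : 'I_n stands
   for the vertex i + 1 of [n]; this shift preserves the order of insertion,
   and vertex 1 is [ord0]. *)
Notation ugraph n := {set {set 'I_n}}.

Section Graph.
Context (n : nat).
Implicit Types (G : ugraph n) (u v : 'I_n).

Definition adj G : rel 'I_n := fun u v => [set u; v]%SET \in G.

Definition simple_path_of_length G u v (k : nat) : bool :=
  [exists p : k.-tuple 'I_n,
    [&& path (adj G) u p, uniq (u :: p) & last u p == v]].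

(* The least length of a path from u to v; in a tree this path is unique.
   A simple path has fewer than n edges, and the value is n by convention if
   u and v are not connected. *)
Definition dist G u v : nat := find (simple_path_of_length G u v) (iota 0 n).

Definition closeness G v : nat := \sum_(u : 'I_n | u != v) dist G v u.

(* Smaller closeness is more central; among vertices of equal closeness, the
   one inserted last comes first. *)
Definition ranked_before G u v : bool :=
  (closeness G u < closeness G v)%N ||
  (closeness G u == closeness G v) && (v < u)%N.

(* The position of v, counted from 1, for the strict total order
   [ranked_before G]. *)
Definition closeness_rank G v : nat :=
  #|[set u | ranked_before G u v]%SET|.+1.

(* The graph on [n.+1] obtained by adding the vertex [ord_max] and an edge
   joining it to i. *)
Definition add_vertex G (i : 'I_n) : ugraph n.+1 :=
  ([set [set widen_ord (leqnSn n) x | x in e] | e : {set 'I_n} in G]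
   :|: [set [set widen_ord (leqnSn n) i; ord_max]])%SET.

End Graph.

Local Open Scope classical_set_scope.
Local Open Scope ring_scope.
Local Open Scope ereal_scope.

Section Random.
Context (R : realType) (d : measure_display) (Omega : measurableType d).
Variable P : probability Omega R.

(* The random element X, with values in a finite type, is independent of the
   random graphs T 1, ..., T n.  Since these take finitely many values, it is
   enough to consider the product events {T 1 in A 1, ..., T n in A n}. *)
Definition independent_of_past (T : forall n, Omega -> ugraph n)
    (n : nat) (I : finType) (X : Omega -> I) : Prop :=
  forall (i : I) (A : forall k, set (ugraph k)),
    let past := [set w | forall k, (0 < k <= n)%N -> A k (T k w)] in
    P ([set w | X w = i] `&` past) = P [set w | X w = i] * P past.

(* T n is the tree on [n] for n >= 1; T 0 plays no role.  The measurability of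
   the T n follows from that of the attachment vertices X. *)
Definition is_urrt (T : forall n, Omega -> ugraph n) : Prop :=
  (forall w, T 1%N w = finset.set0) /\
  forall n, (0 < n)%N -> exists X : Omega -> 'I_n,
    [/\ forall i, measurable [set w | X w = i],
        forall i, P [set w | X w = i] = (n%:R^-1)%:E,
        independent_of_past T n X &
        forall w, T n.+1 w = add_vertex (T n w) (X w)].

Definition tight (Y : nat -> Omega -> nat) : Prop :=
  forall eps : R, (0 < eps)%R ->
    exists K : nat, (0 < K)%N /\
      forall n, (1 - eps)%:E <= P [set w | (Y n w <= K)%N].

(* The sequence R_1, R_2, ... reindexed from 0. *)
Definition root_rank (T : forall n, Omega -> ugraph n) (n : nat) (w : Omega)
  : nat := closeness_rank (T n.+1 w) ord0.

End Random.

(* Main.v *)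
(* Let c be a grandchild of the root 1, and let O be the set of vertices which
   are not descendants of c. Moving from c to the root shifts the distance to
   every descendant of c by 2, so closeness(1) >= closeness(c) + 2 n - 4 |O|,
   while a neighbour of c has closeness less than closeness(c) + n. Hence, as
   soon as |O| <= n / 4, all neighbours of c are more central than the root.
   With positive probability |O| = 2 when n = 16; from then on |O| / n is a
   martingale, so by Markov's inequality it stays below 1/4 at any given later
   time with probability at least 1/2, while the degree of c tends to infinity
   in probability. *)
Require Import Defs.
From mathcomp Require Import all_boot all_order all_algebra.
From mathcomp Require Import all_classical all_reals all_analysis.
From mathcomp Require Import zify ring lra.

Set Implicit Arguments.
Unset Strict Implicit.
Unset Printing Implicit Defensive.

Import Order.TTheory GRing.Theory Num.Theory.

(** * Distances as lengths of shortest walks, and closeness of neighbours *)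

Section Distance.
Context (n : nat) (G : ugraph n).
Implicit Types u v w : 'I_n.

Lemma adj_sym u v : adj G u v = adj G v u.
Proof. by rewrite /adj finset.setUC. Qed.

Lemma dist_le u v : (dist G u v <= n)%N.
Proof. by rewrite -[leqRHS](size_iota 0 n) find_size. Qed.

(** Removing the loops of a walk gives a simple path that is no longer and has fewer than [n] edges,
    hence lies within the range searched by [dist]. *)
Lemma walk_dist u p : path (adj G) u p -> (dist G u (last u p) <= size p)%N.
Proof.
case/shortenP => p' path_p' uniq_p' sub_p'.
have le_p' : (size p' <= size p)%N.
  by apply: uniq_leq_size => //; case/andP: uniq_p'.
have lt_p' : (size p' < n)%N.
  by have := max_card (mem (u :: p')); rewrite (card_uniqP uniq_p') card_ord.
apply: leq_trans le_p'; rewrite leqNgt; apply/negP => lt_find.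
have := before_find 0%N lt_find; rewrite nth_iota // add0n => /negbT/negP; apply.
apply/existsP; exists (in_tuple p').
by apply/and3P; split.
Qed.

Lemma dist_walk u v : (dist G u v < n)%N ->
  exists2 p, path (adj G) u p & last u p = v /\ size p = dist G u v.
Proof.
move=> lt_n; have := lt_n; rewrite -[X in (_ < X)%N -> _](size_iota 0 n) -has_find.
move=> /(nth_find 0%N); rewrite nth_iota // add0n => /existsP[p /and3P[pp _ /eqP lp]].
by exists p => //; split=> //; rewrite size_tuple.
Qed.

Lemma connect_dist u v : connect (adj G) u v -> (dist G u v < n)%N.
Proof.
case/connectP => p /shortenP[p' path_p' uniq_p' _] ->.
apply: leq_ltn_trans (walk_dist path_p') _.
by have := max_card (mem (u :: p')); rewrite (card_uniqP uniq_p') card_ord.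
Qed.

Lemma dist_refl u : dist G u u = 0%N.
Proof. by apply/eqP; rewrite -leqn0; exact: (@walk_dist u [::]). Qed.

Lemma dist_adj u v : adj G u v -> (dist G u v <= 1)%N.
Proof. by move=> uv; apply: (@walk_dist u [:: v]); rewrite /= uv. Qed.

Lemma dist_triangle w u v : (dist G u v <= dist G u w + dist G w v)%N.
Proof.
(* If a distance on the right is the default value [n], the bound is [dist_le]; otherwise two walks
   are concatenated. *)
have [lt1|ge1] := ltnP (dist G u w) n; last first.
  by rewrite (leq_trans (dist_le u v)) // (leq_trans ge1) // leq_addr.
have [lt2|ge2] := ltnP (dist G w v) n; last first.
  by rewrite (leq_trans (dist_le u v)) // (leq_trans ge2) // leq_addl.
have [p pp [lp <-]] := dist_walk lt1; have [q pq [lq <-]] := dist_walk lt2.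
rewrite -size_cat -lq -[in last w q]lp -last_cat; apply: walk_dist.
by rewrite cat_path pp lp.
Qed.

Lemma closenessE v : closeness G v = (\sum_u dist G v u)%N.
Proof. by rewrite [RHS](bigD1 v) //= dist_refl. Qed.

(** Each distance grows by at most 1 from [v] to [u], and the term at [u] itself becomes 0, so the
    total growth is at most [n - 1]; this gives strictness. *)
Lemma closeness_adj u v : adj G u v -> (closeness G u < closeness G v + n)%N.
Proof.
move=> uv; rewrite !closenessE -[X in (_ + X)%N]card_ord -sum1_card -big_split /=.
rewrite (bigD1 u) //= [ltnRHS](bigD1 u) //= dist_refl.
rewrite add0n addn1 addSn ltnS.
apply: leq_trans (leq_addl _ _); apply: leq_sum => w _.
apply: leq_trans (dist_triangle v u w) _.
by rewrite addnC leq_add2l dist_adj.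
Qed.

End Distance.

(** * The cut above a grandchild of the root *)

(* c is a grandchild of the root r, through b, and O consists of the vertices
   which are not descendants of c. *)
Record grandchild_cut n (G : ugraph n) (r b c : 'I_n) (O : {set 'I_n}) : Prop := {
  cut_root : val r = 0%N;
  cut_rO : r \in O;
  cut_bO : b \in O;
  cut_cO : c \notin O;
  cut_neq : r != b;
  cut_rb : adj G r b;
  cut_bc : adj G b c;
  cut_edge : forall u w, u \in O -> w \notin O -> adj G u w -> u = b /\ w = c;
  cut_connected : forall u, connect (adj G) r u }.

Section Cut.
Context (n : nat) (G : ugraph n) (r b c : 'I_n) (O : {set 'I_n}).
Hypothesis cutG : grandchild_cut G r b c O.

(** The first exit from [O] is along the edge from [b] to [c], and what follows is a walk from [c].
    The term [u != b] counts the step needed to reach [b]; a start at the root thus gains 2 in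
    all. *)
Lemma cut_walk u p : u \in O -> path (adj G) u p -> last u p \notin O ->
  ((u != b) + (dist G c (last u p)).+1 <= size p)%N.
Proof.
elim: p u => [|w p IHp] u uO /=; first by rewrite uO.
case/andP => uw path_p last_p.
have [wO|wO] := boolP (w \in O).
  rewrite (leq_trans (leq_add (leq_b1 _) (leqnn _))) // add1n ltnS.
  by rewrite (leq_trans _ (IHp w wO path_p last_p)) // leq_addl.
have [-> ->] := cut_edge cutG uO wO uw.
rewrite eqxx add0n ltnS.
have [_ wc] := cut_edge cutG uO wO uw.
by rewrite wc in path_p *; apply: walk_dist.
Qed.

Lemma cut_dist u : u \notin O -> (dist G c u + 2 <= dist G r u)%N.
Proof.
move=> uO; have [p pp [lp <-]] := dist_walk (connect_dist (cut_connected cutG u)).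
have := cut_walk (cut_rO cutG) pp; rewrite lp (cut_neq cutG) => /(_ uO); lia.
Qed.

Lemma cut_dist_root u : (dist G c u <= dist G r u + 2)%N.
Proof.
apply: leq_trans (dist_triangle G r c u) _; rewrite addnC leq_add2l.
apply: leq_trans (dist_triangle G b c r) _.
by rewrite (leq_add (n1 := 1) (n2 := 1)) // dist_adj // adj_sym
  ?(cut_rb cutG) ?(cut_bc cutG).
Qed.

Lemma closeness_root_cut :
  (closeness G c + 2 * n <= closeness G r + 4 * #|O|)%N.
Proof.
rewrite !closenessE (bigID (mem O)) /= [X in (_ <= X + _)%N](bigID (mem O)) /=.
have le1 : (\sum_(u in O) dist G c u <= \sum_(u in O) dist G r u + 2 * #|O|)%N.
  rewrite mulnC -sum_nat_const -big_split /=.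
  by apply: leq_sum => u _; exact: cut_dist_root.
have le2 : (\sum_(u | u \notin O) dist G c u + 2 * #|~: O|
            <= \sum_(u | u \notin O) dist G r u)%N.
  rewrite mulnC -sum_nat_const.
  rewrite (eq_bigl (fun u => u \notin O) (fun=> 2%N)); last first.
    by move=> u; rewrite finset.in_setC.
  by rewrite -big_split /=; apply: leq_sum => u; exact: cut_dist.
move: (cardsC O) le1 le2; rewrite card_ord.
set a1 := bigop.body _ _ _; set b1 := bigop.body _ _ _.
set a2 := bigop.body _ _ _; set b2 := bigop.body _ _ _.
set o1 := card.body _; set o2 := card.body _.
lia.
Qed.

(** A neighbour of [c] has closeness below that of [c] plus [n], which is at most that of [r] plus
    [4 |O| - n]. The comparison with [r] is strict, so the tie-breaking rule never intervenes. *)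
Lemma cut_rank : (4 * #|O| <= n)%N ->
  (#|[set v | adj G c v]%SET| < closeness_rank G r)%N.
Proof.
move=> le_O; rewrite ltnS; apply/subset_leq_card/fintype.subsetP => v.
rewrite !inE /ranked_before adj_sym => /closeness_adj lt_v.
apply/orP; left; have := closeness_root_cut; lia.
Qed.

End Cut.

(** * Effect of one attachment on adjacency, degree and the cut *)

Section AddVertex.
Context (n : nat) (G : ugraph n) (i : 'I_n).
Local Notation widen := (widen_ord (leqnSn n)).

Lemma ord_widen_max (w : 'I_n.+1) : w = ord_max \/ exists u, w = widen u.
Proof.
have [lt_w|ge_w] := ltnP w n.
  by right; exists (Ordinal lt_w); apply: val_inj.
by left; apply: val_inj => /=; apply/eqP; rewrite eqn_leq ge_w -ltnS ltn_ord.
Qed.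

Lemma widen_inj : injective widen.
Proof. by move=> u v /(congr1 val) /= /val_inj. Qed.

Lemma widen_neq_max u : (widen u == ord_max) = false.
Proof. by rewrite -val_eqE /= ltn_eqF. Qed.

Lemma adj_widen u v : adj G u v -> adj (add_vertex G i) (widen u) (widen v).
Proof.
move=> uv; rewrite /adj !inE; apply/orP; left; apply/imsetP.
by exists [set u; v]%SET => //; rewrite imsetU1 imset_set1.
Qed.

Lemma adj_widen_max : adj (add_vertex G i) (widen i) ord_max.
Proof. by rewrite /adj !inE eqxx orbT. Qed.

Lemma adj_widen_inv u v : adj (add_vertex G i) (widen u) (widen v) -> adj G u v.
Proof.
rewrite /adj !inE => /orP[/imsetP[e eG] eq_e|/eqP eq_e]; last first.
  have : ord_max \in [set widen u; widen v]%SET by rewrite eq_e !inE eqxx orbT.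
  by rewrite !inE ![ord_max == _]eq_sym !widen_neq_max.
suff -> : [set u; v]%SET = e by [].
apply: (imset_inj widen_inj); rewrite -eq_e imsetU1 imset_set1 //.
Qed.

Lemma adj_max_inv u : adj (add_vertex G i) (widen u) ord_max -> u = i.
Proof.
rewrite /adj !inE => /orP[/imsetP[e eG] eq_e|/eqP eq_e].
  have : ord_max \in [set widen u; ord_max]%SET by rewrite !inE eqxx orbT.
  by rewrite eq_e => /imsetP[x _ /eqP]; rewrite eq_sym widen_neq_max.
have : widen u \in [set widen u; ord_max]%SET by rewrite !inE eqxx.
by rewrite eq_e !inE widen_neq_max orbF => /eqP/widen_inj.
Qed.

(** The new vertex is a descendant of [c] exactly when its parent is, so it takes the side of its
    parent. *)
Definition extend_set (O : {set 'I_n}) : {set 'I_n.+1} :=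
  (widen @: O :|: [set w | (w == ord_max) && (i \in O)])%SET.

Lemma extend_set_widen O u : (widen u \in extend_set O) = (u \in O).
Proof. by rewrite !inE widen_neq_max orbF mem_imset //; exact: widen_inj. Qed.

Lemma extend_set_max O : (ord_max \in extend_set O) = (i \in O).
Proof.
rewrite !inE eqxx /=; case: imsetP => // -[u _ /eqP].
by rewrite eq_sym widen_neq_max.
Qed.

Lemma card_extend_set O : (#|extend_set O| <= #|O| + (i \in O))%N.
Proof.
rewrite (leq_trans (leq_card_setU _ _)) // card_imset; last exact: widen_inj.
rewrite leq_add2l; case: (i \in O).
  by rewrite (eq_card (B := pred1 ord_max)) ?card1 // => w; rewrite !inE andbT.
by rewrite (eq_card0) // => w; rewrite !inE andbF.
Qed.

Lemma add_vertex_degree c :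
  (#|[set v | adj G c v]%SET| + (i == c) <=
   #|[set v | adj (add_vertex G i) (widen c) v]%SET|)%N.
Proof.
rewrite -(card_imset _ widen_inj).
have sub : (widen @: [set v | adj G c v] \subset
            [set v | adj (add_vertex G i) (widen c) v])%SET.
  apply/fintype.subsetP => _ /imsetP[v + ->]; rewrite !inE; exact: adj_widen.
have [ic|_] := eqVneq i c; last by rewrite addn0 subset_leq_card.
rewrite addn1; apply: proper_card.
apply/fintype.properP; split=> //; exists ord_max; first by rewrite inE -ic adj_widen_max.
by apply/imsetP => -[u _ /eqP]; rewrite eq_sym widen_neq_max.
Qed.

Lemma connect_widen u v :
  connect (adj G) u v -> connect (adj (add_vertex G i)) (widen u) (widen v).
Proof.
case/connectP => p path_p ->; apply/connectP; exists (map widen p).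
  by apply: homo_path path_p => x y; exact: adj_widen.
by rewrite last_map.
Qed.

Lemma connect_add_vertex r : (forall u, connect (adj G) r u) ->
  forall w, connect (adj (add_vertex G i)) (widen r) w.
Proof.
move=> conn w; have [->|[u ->]] := ord_widen_max w; last exact: connect_widen.
by apply: connect_trans (connect_widen (conn i)) (connect1 adj_widen_max).
Qed.

(** The new edge has both ends on the same side, so the edge from [b] to [c] remains the only one
    that crosses. *)
Lemma add_vertex_cut r b c O : grandchild_cut G r b c O ->
  grandchild_cut (add_vertex G i) (widen r) (widen b) (widen c) (extend_set O).
Proof.
case=> r0 rO bO cO rb adj_rb adj_bc edge conn; split=> //.
- by rewrite extend_set_widen.
- by rewrite extend_set_widen.
- by rewrite extend_set_widen.
- exact: adj_widen.
- exact: adj_widen.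
- move=> u w; have [->|[u' ->]] := ord_widen_max u;
    have [->|[w' ->]] := ord_widen_max w;
    rewrite ?extend_set_widen ?extend_set_max.
  + by move=> ->.
  + by move=> iO wO; rewrite adj_sym => /adj_max_inv eq_w; rewrite eq_w iO in wO.
  + by move=> uO iO /adj_max_inv eq_u; rewrite -eq_u uO in iO.
  + by move=> uO wO /adj_widen_inv /(edge _ _ uO wO)[-> ->].
- exact: connect_add_vertex.
Qed.

(** This creates the initial cut: a new leaf below a child of the root has no descendant but itself,
    so [O] consists of all older vertices. *)
Lemma grandchild_cut_leaf (r : 'I_n) : val r = 0%N -> r != i -> adj G r i ->
  (forall u, connect (adj G) r u) ->
  grandchild_cut (add_vertex G i) (widen r) (widen i) ord_max
    (widen @: [set: 'I_n])%SET.
Proof.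
move=> r0 ri adj_ri conn; split=> //.
- by apply: imset_f; rewrite inE.
- by apply: imset_f; rewrite inE.
- by apply/imsetP => -[u _ /eqP]; rewrite eq_sym widen_neq_max.
- exact: adj_widen.
- exact: adj_widen_max.
- move=> _ w /imsetP[u _ ->]; have [->|[v ->]] := ord_widen_max w.
    by move=> _ /adj_max_inv ->.
  by rewrite imset_f // inE.
- exact: connect_add_vertex.
Qed.
End AddVertex.

Local Open Scope ring_scope.

(** * Iterated means over the attachment process *)

Section MeanValue.
Context (R : realType).

(* The expectation of f (n + j) (T (n + j)) given that T n is G. *)
Fixpoint attach_mean (f : forall n, ugraph n -> R) j n (G : ugraph n) : R :=
  if j is j'.+1 then n%:R^-1 * \sum_(i < n) attach_mean f j' (add_vertex G i)
  else f n G.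

(** The root is selected by its value because [ord0] needs a successor, while [attach_mean] takes a
    function defined for every [n]. *)
Definition root_rank_gt K n (G : ugraph n) : R :=
  [exists r : 'I_n, (val r == 0%N) && (K < closeness_rank G r)%N]%:R.

Lemma attach_mean_ge0 f j n (G : ugraph n) :
  (forall m (H : ugraph m), 0 <= f m H) -> 0 <= attach_mean f j G.
Proof.
move=> f_ge0; elim: j n G => [|j IHj] n G //=.
by rewrite mulr_ge0 ?invr_ge0 ?ler0n // sumr_ge0.
Qed.

(** Keeping a single attachment vertex of the average serves to force the first few steps of the
    process. *)
Lemma attach_mean_ge_term f j n (G : ugraph n) (i : 'I_n) :
  (forall m (H : ugraph m), 0 <= f m H) ->
  n%:R^-1 * attach_mean f j (add_vertex G i) <= attach_mean f j.+1 G.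
Proof.
move=> f_ge0; rewrite /= ler_wpM2l ?invr_ge0 ?ler0n // (bigD1 i) //= lerDl.
by rewrite sumr_ge0 // => k _; exact: attach_mean_ge0.
Qed.

(** One step of a telescoping bound: the product of the factors [1 - 1 / (2 m)] for [n <= m < N] is
    at most the square root of [n / N]. *)
Lemma sqrt_ratio_step n N : (0 < n)%N -> (0 < N)%N ->
  (1 - (2 * n%:R)^-1) * Num.sqrt (n.+1%:R / N%:R) <= Num.sqrt (n%:R / N%:R) :> R.
Proof.
move=> n_gt0 N_gt0; have n_ge1 : 1 <= n%:R :> R by rewrite ler1n.
have Nr : 0 < N%:R :> R by rewrite ltr0n.
have c_ge0 : 0 <= 1 - (2 * n%:R)^-1 :> R.
  rewrite subr_ge0 invf_le1; lra.
rewrite -(@ler_pXn2r _ 2) ?nnegrE ?mulr_ge0 ?sqrtr_ge0 //.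
rewrite exprMn !sqr_sqrtr ?divr_ge0 ?ler0n // mulrA.
rewrite ler_pM2r ?invr_gt0 // -(natr1 n) invfM.
have y_gt0 : 0 < n%:R^-1 :> R by rewrite invr_gt0 ltr0n.
have y_le1 : n%:R^-1 <= 1 :> R by rewrite invf_le1 ?ltr0n.
have xy : n%:R * n%:R^-1 = 1 :> R by rewrite mulfV // pnatr_eq0 -lt0n.
move: xy y_gt0 y_le1; set x := n%:R; set y := x^-1 => xy y_gt0 y_le1.
(* Since [x * y = 1], the right side equals [x - 3 y / 4 + y ^+ 2 / 4], which is at most [x] because
   [0 < y <= 1]. *)
have -> : (1 - 2^-1 * y) ^+ 2 * (x + 1)
    = x + 1 - y + y ^+ 2 / 4 - (x * y) + (x * y) * y / 4 by field.
by rewrite xy; nra.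
Qed.

(* Markov's inequality for |O|, which is a martingale after division by n, and
   for 2^-deg c, whose conditional mean is multiplied by 1 - 1 / (2 n) at each
   step. *)
Lemma attach_mean_lower K j n (G : ugraph n) r b c O : (0 < n)%N ->
  grandchild_cut G r b c O ->
  1 - 4 * #|O|%:R / n%:R
    - 2 ^+ K * 2^-1 ^+ #|[set v | adj G c v]%SET| * Num.sqrt (n%:R / (n + j)%:R)
  <= attach_mean (root_rank_gt K) j G.
Proof.
elim: j n G r b c O => [|j IHj] n G r b c O n_gt0 cutG.
  rewrite addn0 divff ?pnatr_eq0 -?lt0n // sqrtr1 mulr1 /= /root_rank_gt.
  case: existsP => [_|no_rank].
    rewrite -addrA -opprD gerBl addr_ge0 ?mulr_ge0 ?exprn_ge0 ?invr_ge0 //.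
  have rank_le : (closeness_rank G r <= K)%N.
    rewrite leqNgt; apply/negP => rank_gt; apply: no_rank; exists r.
    by rewrite (cut_root cutG) eqxx.
  rewrite -addrA -opprD subr_le0.
  (* One of the two subtracted terms is at least 1: the second if [O] is small, since then [c] has
     degree below the rank of the root, hence below [K], and the first otherwise. *)
  have [le_O|gt_O] := leqP (4 * #|O|) n.
    rewrite ler_wpDl ?divr_ge0 ?mulr_ge0 ?ler0n //.
    have le_K := leq_trans (cut_rank cutG le_O) rank_le.
    rewrite exprVn ler_pdivlMr ?exprn_gt0 // mul1r ler_eXn2l ?ltr1n //.
    exact: ltnW.
  rewrite ler_wpDr ?mulr_ge0 ?exprn_ge0 ?invr_ge0 //.
  by rewrite ler_pdivlMr ?ltr0n // mul1r -natrM ler_nat ltnW.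
set o := #|_|; set d := #|_|.
set B : R := 2 ^+ K * 2^-1 ^+ d * Num.sqrt (n.+1%:R / (n + j.+1)%:R).
have B_ge0 : 0 <= B by rewrite !mulr_ge0 ?exprn_ge0 ?invr_ge0 ?sqrtr_ge0.
have nr : 0 < n%:R :> R by rewrite ltr0n.
(* [B] is the degree term at the next time with the degree unchanged; a new neighbour of [c] halves
   it, which is the factor [1 - 2^-1 * (i == c)]. *)
have step (i : 'I_n) : 1 - 4 * (o%:R + (i \in O)%:R) / n.+1%:R
    - B * (1 - 2^-1 * (i == c)%:R) <= attach_mean (root_rank_gt K) j (add_vertex G i).
  apply: le_trans (IHj _ _ _ _ _ _ (ltn0Sn n) (add_vertex_cut i cutG)).
  rewrite lerB // ?lerB //.
    rewrite ler_pM2r ?invr_gt0 ?ltr0n // ler_pM2l // -natrD ler_nat.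
    exact: card_extend_set.
  rewrite addSnnS /B -!mulrA ler_wpM2l ?exprn_ge0 // [X in _ <= X]mulrA [leRHS]mulrAC.
  rewrite ler_wpM2r ?sqrtr_ge0 //.
  have := add_vertex_degree G i c; rewrite -/d => le_d.
  apply: le_trans (_ : 2^-1 ^+ (d + (i == c)) <= _).
    by rewrite ler_wiXn2l ?invr_ge0 ?invf_le1 ?ler1n.
  rewrite exprD ler_wpM2l ?exprn_ge0 ?invr_ge0 //.
  by case: (i == c); rewrite ?expr1 ?expr0 ?mulr1n ?mulr0n; lra.
rewrite /=; apply: le_trans (_ : n%:R^-1 *
    \sum_(i < n) (1 - 4 * (o%:R + (i \in O)%:R) / n.+1%:R
    - B * (1 - 2^-1 * (i == c)%:R)) <= _); last first.
  by rewrite ler_wpM2l ?invr_ge0 ?ler0n // ler_sum.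
have sum_O : \sum_(i < n) (i \in O)%:R = o%:R :> R.
  by rewrite -natr_sum -big_mkcond sum1_card.
have sum_c : \sum_(i < n) (i == c)%:R = 1 :> R.
  by rewrite -natr_sum -big_mkcond big_pred1_eq.
(* The sizes of the new [O] sum to [(n + 1) o], which cancels the denominator: this is the
   martingale property of [|O| / n]. *)
have -> : \sum_(i < n) (1 - 4 * (o%:R + (i \in O)%:R) / n.+1%:R
    - B * (1 - 2^-1 * (i == c)%:R))
    = n%:R - 4 * o%:R - B * (n%:R - 2^-1).
  rewrite sumrB -[X in _ - X]mulr_sumr [X in _ - B * X]sumrB.
  rewrite -[X in _ * (_ - X)]mulr_sumr sum_c.
  rewrite sumrB -mulr_suml -mulr_sumr big_split /= sum_O !sumr_const card_ord.
  have n1_neq0 : n%:R + 1 != 0 :> R by rewrite natr1 pnatr_eq0.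
  rewrite -(mulr_natl 1 n) -(mulr_natl o%:R n) mulr1 -(natr1 n).
  move: (B) (n%:R) (o%:R) n1_neq0 => B' x y x1_neq0; field; exact: x1_neq0.
have le_qp := @sqrt_ratio_step n (n + j.+1) n_gt0 (ltn_addr _ n_gt0).
have M_ge0 : 0 <= 2 ^+ K * 2^-1 ^+ d :> R.
  by rewrite mulr_ge0 ?exprn_ge0 ?invr_ge0.
apply: le_trans (lerB (lexx _) (ler_wpM2l M_ge0 le_qp)) _; rewrite /B.
move: (2 ^+ K * _) (Num.sqrt _) (n%:R) (o%:R) (gt_eqF nr) => M q x y x_neq0.
rewrite le_eqVlt; apply/orP; left; apply/eqP; field.
by rewrite x_neq0.
Qed.
End MeanValue.

(** * Starting configuration and time horizon *)

Section Start.
Context (R : realType).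

(** The horizon is chosen so that [16 / (256 * 4 ^ K)] is the square of [2 ^- K / 4]. *)
Lemma sqrt_ratio_le K :
  2 ^+ K * Num.sqrt (16%:R / (16 + 256 * 4 ^ K)%:R) <= 4^-1 :> R.
Proof.
have K_gt0 : 0 < 2 ^+ K :> R by rewrite exprn_gt0.
rewrite -ler_pdivlMl // -(@ler_pXn2r _ 2) ?nnegrE ?sqrtr_ge0 ?mulr_ge0
  ?invr_ge0 ?(ltW K_gt0) //.
rewrite sqr_sqrtr ?divr_ge0 ?ler0n // exprMn.
have -> : (16 + 256 * 4 ^ K)%:R = 16 + 256 * (2 ^+ K) ^+ 2 :> R.
  by rewrite natrD natrM natrX exprAC -(natrX _ 2 2).
move: (2 ^+ K) K_gt0 => x x_gt0.
rewrite ler_pdivrMr; last by nra.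
have -> : x^-1 ^+ 2 * 4^-1 ^+ 2 * (16 + 256 * x ^+ 2) = x^-1 ^+ 2 + 16.
  by field; rewrite gt_eqF.
by rewrite lerDr exprn_ge0 // invr_ge0 ltW.
Qed.

(** Until there are 16 vertices, every new vertex is forced onto [c], which keeps [O] from growing;
    each such step has probability at least [1 / 16]. *)
Lemma attach_mean_start K k n (G : ugraph n) r b c (O : {set 'I_n}) :
  (0 < n)%N -> (n + k = 16)%N -> (#|O| <= 2)%N -> grandchild_cut G r b c O ->
  16^-1 ^+ k * 4^-1 <= attach_mean (@root_rank_gt R K) (k + 256 * 4 ^ K) G.
Proof.
elim: k n G r b c O => [|k IHk] n G r b c O n_gt0 n16 le_O cutG.
  rewrite addn0 in n16; subst n; apply: le_trans (attach_mean_lower R K _ n_gt0 cutG).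
  rewrite add0n expr0 mul1r.
  have := @sqrt_ratio_le K; set q := Num.sqrt _ => le_q.
  have : 2 ^+ K * 2^-1 ^+ #|[set v | adj G c v]%SET| * q <= 2 ^+ K * q.
    rewrite ler_wpM2r ?sqrtr_ge0 // ler_piMr ?exprn_ge0 //.
    by rewrite exprn_ile1 // invf_le1 ?ler1n.
  have : #|O|%:R <= 2 :> R by rewrite ler_nat.
  (* With 16 vertices the bound is at least [1 - 4 * 2 / 16 - 1 / 4 = 1 / 4]. *)
  move: le_q; move: (_ * q) (_ * q) (#|O|%:R) => x y z; lra.
rewrite addSn; apply: le_trans (attach_mean_ge_term _ _ c _); last first.
  by move=> m H; rewrite ler0n.
have le_IH : 16^-1 ^+ k * 4^-1 <=
    attach_mean (@root_rank_gt R K) (k + 256 * 4 ^ K) (add_vertex G c).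
  apply: IHk (add_vertex_cut c cutG) => //; first by rewrite -n16 addSnnS.
  by rewrite (leq_trans (card_extend_set _ _)) // (negbTE (cut_cO cutG)) addn0.
rewrite exprS -mulrA ler_pM ?invr_ge0 ?mulr_ge0 ?exprn_ge0 ?invr_ge0 //.
by rewrite lef_pV2 ?posrE ?ltr0n // ler_nat -n16 leq_addr.
Qed.

(** The path 1, 2, 3 is forced: the first attachment is certain and the second has probability
    [1 / 2]. Then 13 further attachments to vertex 3 lead to 16 vertices. *)
Lemma attach_mean_root K :
  2^-1 * (16^-1 ^+ 13 * 4^-1) <=
  attach_mean (@root_rank_gt R K) (15 + 256 * 4 ^ K) (finset.set0 : ugraph 1).
Proof.
have f_ge0 m (H : ugraph m) : 0 <= root_rank_gt R K H by rewrite ler0n.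
apply: le_trans (@attach_mean_ge_term R _ _ 1 _ ord0 f_ge0).
rewrite invr1 mul1r.
set G2 := add_vertex _ _.
apply: le_trans (@attach_mean_ge_term R _ _ 2 _ ord_max f_ge0).
rewrite ler_wpM2l ?invr_ge0 //.
have adj2 : adj G2 (widen_ord (leqnSn 1) ord0) ord_max by exact: adj_widen_max.
have conn2 u : connect (adj G2) (widen_ord (leqnSn 1) ord0) u.
  by apply: connect_add_vertex => v; rewrite !ord1 connect0.
have := grandchild_cut_leaf (erefl : val (widen_ord (leqnSn 1) ord0) = 0%N) _ adj2 conn2.
move=> /(_ isT) cut3; apply: attach_mean_start cut3 => //.
by rewrite (leq_trans (leq_imset_card _ _)) // cardsT card_ord.
Qed.
End Start.

(** * The law of the tree at a given time, as finite sums *)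

Section Law.
Context (R : realType) (d : measure_display) (Omega : measurableType d).
Variable P : probability Omega R.
Local Open Scope classical_set_scope.

Lemma finite_valued_prob (I : finType) (Y : Omega -> I) (p : pred I) :
  (forall i, measurable [set w | Y w = i]) ->
  measurable [set w | p (Y w)] /\
  P [set w | p (Y w)] = (\sum_(i | p i) P [set w | Y w = i])%E.
Proof.
move=> mY; pose r := [seq i <- index_enum I | p i].
have -> : [set w | p (Y w)] = \bigcup_(i in [set` r]) [set w | Y w = i].
  apply/seteqP; split=> w /=.
    by move=> pw; exists (Y w) => //=; rewrite mem_filter pw mem_index_enum.
  by case=> i /=; rewrite mem_filter => /andP[pi _] ->.
split; first by apply: fin_bigcup_measurable => // i _; exact: mY.
rewrite measure_fin_bigcup //; last by move=> i j _ _ [w []] /= <- <-.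
rewrite -fsbig_seq; last by rewrite filter_uniq // index_enum_uniq.
by rewrite big_filter.
Qed.

Context (T : forall n, Omega -> ugraph n) (urrtT : is_urrt P T).

Lemma urrt_measurable n (G : ugraph n) :
  (0 < n)%N -> measurable [set w | T n w = G].
Proof.
case: n G => // n + _; elim: n => [|n IHn] G.
  have [G0|G0] := eqVneq G finset.set0.
    rewrite (_ : mkset _ = setT); first exact: measurableT.
    by apply/seteqP; split=> w //= _; rewrite (proj1 urrtT) G0.
  rewrite (_ : mkset _ = set0); first exact: measurable0.
  by apply/seteqP; split=> w //=; rewrite (proj1 urrtT) => /esym/eqP; rewrite (negbTE G0).
have [X [mX _ _ TX]] := proj2 urrtT n.+1 isT.
have mTX (p : ugraph n.+1 * 'I_n.+1) : measurable [set w | (T n.+1 w, X w) = p].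
  rewrite (_ : mkset _ = [set w | T n.+1 w = p.1] `&` [set w | X w = p.2]).
    by apply: measurableI; [exact: IHn|exact: mX].
  by case: p => H i; apply/seteqP; split=> w /= [-> ->].
have [+ _] := finite_valued_prob (fun p => add_vertex p.1 p.2 == G) mTX.
rewrite (_ : mkset _ = [set w | T n.+2 w = G]) //.
by apply/seteqP; split=> w /=; rewrite TX => /eqP.
Qed.

Definition urrt_law n (G : ugraph n) : R := fine (P [set w | T n w = G]).

Lemma urrt_lawE n (G : ugraph n) :
  (0 < n)%N -> P [set w | T n w = G] = (urrt_law G)%:E.
Proof. by move=> n_gt0; rewrite fineK // fin_num_measure //; exact: urrt_measurable. Qed.

(** By independence the pair of [T n] and the attachment vertex has a product law; grouping the
    pairs by the graph they produce gives the law of [T n.+1]. *)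
Lemma urrt_law_step n (f : ugraph n.+1 -> R) : (0 < n)%N ->
  \sum_H urrt_law H * f H =
  \sum_(G : ugraph n) urrt_law G * (n%:R^-1 * \sum_(i < n) f (add_vertex G i)).
Proof.
move=> n_gt0; have [X [mX PX indX TX]] := proj2 urrtT n n_gt0.
have pairE (G : ugraph n) i :
    [set w | (T n w, X w) = (G, i)] = [set w | X w = i] `&` [set w | T n w = G].
  by apply/seteqP; split=> w /= [-> ->].
have mTX (p : ugraph n * 'I_n) : measurable [set w | (T n w, X w) = p].
  case: p => G i; rewrite pairE.
  by apply: measurableI; [exact: mX|exact: urrt_measurable].
have PTX (p : ugraph n * 'I_n) :
    P [set w | (T n w, X w) = p] = (urrt_law p.1 * n%:R^-1)%:E.
  case: p => G i; rewrite pairE.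
  (* This family of events constrains only time [n], where it says that the graph is [G]; the
     transport along [e] makes it well typed at every [k]. *)
  have := indX i (fun k H => forall e : n = k, eq_rect n (fun k => ugraph k) G k e = H).
  rewrite /= (_ : mkset (fun w => forall k, _) = [set w | T n w = G]); last first.
    apply/seteqP; split=> w /=.
      by move=> /(_ n) /(_ _ erefl) /= -> //; rewrite n_gt0 leqnn.
    by move=> TG k _ e; case: k / e.
  by move=> ->; rewrite PX urrt_lawE // -EFinM mulrC.
have lawE H : urrt_law H =
    \sum_(p : ugraph n * 'I_n | add_vertex p.1 p.2 == H) urrt_law p.1 * n%:R^-1.
  apply: EFin_inj; rewrite -urrt_lawE // -sumEFin.
  have [_] := finite_valued_prob (fun p => add_vertex p.1 p.2 == H) mTX.
  rewrite (_ : mkset _ = [set w | T n.+1 w = H]); last first.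
    by apply/seteqP; split=> w /=; rewrite TX => /eqP.
  by move=> ->; apply: eq_bigr => p _; exact: PTX.
transitivity (\sum_(p : ugraph n * 'I_n)
    urrt_law p.1 * n%:R^-1 * f (add_vertex p.1 p.2)).
  rewrite [RHS](partition_big (fun p => add_vertex p.1 p.2) xpredT) //=.
  apply: eq_bigr => H _; rewrite lawE mulr_suml.
  by apply: eq_bigr => p /eqP <-.
rewrite -(pair_bigA _ (fun G i => urrt_law G * n%:R^-1 * f (add_vertex G i))) /=.
by apply: eq_bigr => G _; rewrite mulrA mulr_sumr.
Qed.

Lemma urrt_law_mean (f : forall n, ugraph n -> R) j n : (0 < n)%N ->
  \sum_(G : ugraph n) urrt_law G * attach_mean f j G =
  \sum_(G : ugraph (j + n)) urrt_law G * f (j + n)%N G.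
Proof.
elim: j n => [|j IHj] n n_gt0 //=.
by rewrite -(urrt_law_step (attach_mean f j (n := n.+1))) // IHj // addnS.
Qed.

Lemma urrt_law_total n : (0 < n)%N -> \sum_(G : ugraph n) urrt_law G = 1.
Proof.
move=> n_gt0; apply: EFin_inj; rewrite -sumEFin.
have [_] := finite_valued_prob xpredT (fun G => urrt_measurable G n_gt0).
rewrite (_ : mkset _ = setT) ?probability_setT; last exact/seteqP.
by move=> ->; apply: eq_bigr => G _; rewrite urrt_lawE.
Qed.

Lemma urrt_law1 (G : ugraph 1) : urrt_law G = (G == finset.set0)%:R.
Proof.
rewrite /urrt_law; have [->|G0] := eqVneq G finset.set0.
  rewrite (_ : mkset _ = setT) ?probability_setT //.
  by apply/seteqP; split=> w //= _; exact: (proj1 urrtT).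
rewrite (_ : mkset _ = set0) ?measure0 //.
by apply/seteqP; split=> w //=; rewrite (proj1 urrtT) => /esym/eqP; rewrite (negbTE G0).
Qed.

Lemma root_rank_prob K j :
  P [set w | (root_rank T j w <= K)%N] =
  (1 - attach_mean (@root_rank_gt R K) j (finset.set0 : ugraph 1))%:E.
Proof.
have [_ ->] := finite_valued_prob (fun G => (closeness_rank G ord0 <= K)%N)
  (fun G => @urrt_measurable j.+1 G isT).
under eq_bigr do rewrite urrt_lawE //.
rewrite sumEFin; congr (_%:E); apply/eqP; rewrite eq_sym subr_eq.
rewrite -(@urrt_law_total j.+1) // (bigID (fun G => (closeness_rank G ord0 <= K)%N)) /=.
apply/eqP; congr (_ + _).
have := @urrt_law_mean (@root_rank_gt R K) j 1 isT.
(* The law of [T 1] is a point mass at the empty graph, so a single term survives. *)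
rewrite addn1 (bigD1 finset.set0) //= urrt_law1 eqxx mul1r big1 ?addr0; last first.
  by move=> G /negbTE G0; rewrite urrt_law1 G0 mul0r.
move=> ->; rewrite big_mkcond; apply: eq_bigr => G _.
rewrite -ltnNge /root_rank_gt.
have -> : [exists r : 'I_j.+1, (val r == 0%N) && (K < closeness_rank G r)%N] =
    (K < closeness_rank G ord0)%N.
  apply/existsP/idP => [[r /andP[/eqP r0]]|gtK]; last by exists ord0; rewrite gtK.
  by rewrite (_ : r = ord0) //; apply: val_inj.
by case: ltnP; rewrite ?mulr1 ?mulr0.
Qed.
End Law.

Theorem theorem31 (R : realType) (d : measure_display)
    (Omega : measurableType d) (P : probability Omega R)
    (T : forall n : nat, Omega -> ugraph n) :
  is_urrt P T -> ~ tight P (root_rank T).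
Proof.
move=> urrtT tightT.
(* [delta] does not depend on [K]: the root has rank above [K] with probability at least [delta] in
   the tree on [16 + 256 * 4 ^ K] vertices, which contradicts tightness at [delta / 2]. *)
pose delta : R := 2^-1 * (16^-1 ^+ 13 * 4^-1).
have delta_gt0 : 0 < delta by rewrite !mulr_gt0 ?exprn_gt0 ?invr_gt0.
have [K [_ /(_ (15 + 256 * 4 ^ K)%N)]] :=
  tightT (delta / 2) (divr_gt0 delta_gt0 (ltr0n R 2)).
rewrite root_rank_prob // lee_fin.
have := attach_mean_root R K; rewrite -/delta.
by move: (attach_mean _ _ _) (delta) delta_gt0 => x y; lra.
Qed.
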